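(* If a random variable $X$ is super-heavy-tailed, then $X$ is InvSub.
   Context: For a random variable $X$, $F_X(x)=\mathrm{P}(X\le x)$ is its cumulative distribution function; no density is assumed to exist. A function $v$ is subadditive if $v(x+y)\le v(x)+v(y)$ for all $x,y$ in its domain. A random variable $X$ is super-heavy-tailed if $F_X(0)=0$ and the function $x\mapsto-\log F_X(1/x)$, $x>0$ (with $-\log 0=+\infty$), is subadditive. A random variable $X$ is InvSub (''inverted subadditive'') if $F_X(0)=0$ and the function $F^-_{1/X}(x)=\mathrm{P}(1/X<x)=1-F_X(1/x)$, $x>0$, is subadditive. *)

(* Defs.v *)
From HB Require Import structures.
From mathcomp Require Import all_boot all_order all_algebra.
From mathcomp Require Import all_classical all_reals all_analysis.

Set Implicit Arguments.
Unset Strict Implicit.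
Unset Printing Implicit Defensive.

Import Order.TTheory GRing.Theory Num.Theory.
Import numFieldNormedType.Exports.

Local Open Scope classical_set_scope.
Local Open Scope ring_scope.

(* Values are extended reals because - log F_X (1 / x) may be +oo. For D closed
   under addition, as below, this is subadditivity of v as a function on D. *)
Definition subadditive_on (R : realType) (D : set R) (v : R -> \bar R) : Prop :=
  forall x y : R, D x -> D y -> (v (x + y)%R <= v x + v y)%E.

(* cdf X r is P (X <= r), and lne 0 = -oo, so - lne 0 = +oo. *)
Definition super_heavy_tailed (d : measure_display) (T : measurableType d)
    (R : realType) (P : probability T R) (X : {RV P >-> R}) : Prop :=
  cdf X 0 = 0%E /\
  subadditive_on `]0, +oo[ (fun x : R => - lne (cdf X x^-1%R))%E.

(* F^-_{1/X} (x) = P (1 / X < x). It is used only when F_X (0) = 0, so that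
   the values of X^-1 where X <= 0 (0^-1 = 0 in particular) are irrelevant. *)
Definition inv_strict_cdf (d : measure_display) (T : measurableType d)
    (R : realType) (P : probability T R) (X : {RV P >-> R}) (x : R) : \bar R :=
  P [set w | (X w)^-1 < x].

Definition invsub (d : measure_display) (T : measurableType d)
    (R : realType) (P : probability T R) (X : {RV P >-> R}) : Prop :=
  cdf X 0 = 0%E /\ subadditive_on `]0, +oo[ (inv_strict_cdf X).

Lemma inv_strict_cdfE (d : measure_display) (T : measurableType d)
    (R : realType) (P : probability T R) (X : {RV P >-> R}) (x : R) :
  cdf X 0 = 0%E -> 0 < x -> inv_strict_cdf X x = (1 - cdf X x^-1%R)%E.
Proof.
move=> X0 x0; rewrite /inv_strict_cdf.
have cdfP r : cdf X r = P [set w | X w <= r].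
  rewrite /cdf /distribution /pushforward; congr (P _).
have mle r : measurable [set w | X w <= r].
  rewrite (_ : [set w | X w <= r] = X @^-1` `]-oo, r]).
    by rewrite -[X in measurable X]setTI; exact: measurable_funPT.
  by apply/seteqP; split => w /=; rewrite in_itv.
have -> : [set w | (X w)^-1 < x] =
    ~` [set w | X w <= x^-1] `|` [set w | X w <= 0].
  apply/seteqP; split => w /=.
    case: (leP (X w) 0) => Xw; first by right.
    by rewrite invf_plt// => xX; left; apply/negP; rewrite -ltNge.
  case=> [/negP|Xw]; last by apply: le_lt_trans x0; rewrite invr_le0.
  rewrite -ltNge => xX; rewrite invf_plt//.
  by rewrite posrE; apply: lt_trans xX; rewrite invr_gt0.
rewrite measureU//; first last.
- apply/seteqP; split => w //= [/negP]; rewrite -ltNge => xX Xw.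
  have : x^-1 < 0 by exact: lt_le_trans Xw.
  by rewrite invr_lt0 ltNge ltW.
- exact: measurableC.
rewrite -[RHS]adde0; congr (_ + _)%E; last by rewrite -X0 cdfP.
by rewrite cdfP; exact: probability_setC.
Qed.

(* Main.v *)
Require Import Defs.
From HB Require Import structures.
From mathcomp Require Import all_boot all_order all_algebra.
From mathcomp Require Import all_classical all_reals all_analysis.
From mathcomp Require Import lra.

(** Write [a], [b], [c] for the values of the distribution function at [1 / x],
    [1 / y] and [1 / (x + y)]. Exponentiating subadditivity of
    [- log F_X (1 / x)] turns it into supermultiplicativity, [a * b <= c]
    ([mule_le_of_lne]), whereas subadditivity of [1 - F_X (1 / x)] amounts to
    [a + b - 1 <= c]. The former is stronger for numbers in [[0, 1]], as
    [a * b - (a + b - 1) = (1 - a) * (1 - b) >= 0] ([onem_subadditive]). *)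

Import Order.TTheory GRing.Theory Num.Theory.
Local Open Scope ring_scope.

(** If [a] or [b] vanishes, so does the product, and the hypothesis, whose
    right-hand side may then be infinite, carries no information. Otherwise
    neither logarithm is [-oo], so negation distributes over their sum. *)
Lemma mule_le_of_lne (R : realType) (a b c : \bar R) :
  (0 <= a)%E -> (0 <= b)%E -> (0 <= c)%E ->
  (- lne c <= - lne a + - lne b)%E -> (a * b <= c)%E.
Proof.
rewrite le_eqVlt => /predU1P[<- _ c0 _|a0]; first by rewrite mul0e.
rewrite le_eqVlt => /predU1P[<- c0 _|b0 c0]; first by rewrite mule0.
have lneNy (x : \bar R) : (0 < x)%E -> lne x != -oo%E.
  by case: x => [r| |]//; rewrite lte_fin => r0; rewrite lne_EFin.
rewrite -oppeD; last by rewrite /adde_def (negbTE (lneNy a a0))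
  (negbTE (lneNy b b0)) !andbF.
have pos (x : \bar R) : (0 < x)%E -> x \in `]0%E, +oo%E].
  by move=> x0; rewrite in_itv/= x0 leey.
by rewrite leeN2 -lneM ?pos// lee_lne// in_itv/= ?c0 ?leey// mule_ge0 ?ltW.
Qed.

Lemma onem_subadditive (R : realDomainType) (a b c : R) :
  a <= 1 -> b <= 1 -> a * b <= c -> 1 - c <= (1 - a) + (1 - b).
Proof.
move=> a1 b1 abc.
have : 0 <= (1 - a) * (1 - b) by rewrite mulr_ge0// subr_ge0.
by lra.
Qed.

Theorem theorem4p12 (d : measure_display) (T : measurableType d)
    (R : realType) (P : probability T R) (X : {RV P >-> R}) :
  super_heavy_tailed X -> invsub X.
Proof.
move=> [X0 sub]; split=> // x y Dx Dy.
have [x0 y0] : 0 < x /\ 0 < y.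
  by move: Dx Dy; rewrite /= !in_itv/= !andbT.
have ab_le_c := mule_le_of_lne _ _ _ _ (cdf_ge0 X _) (cdf_ge0 X _)
  (cdf_ge0 X _) (sub x y Dx Dy).
rewrite !inv_strict_cdfE ?addr_gt0//.
have cdf_fin r : cdf X r = (fine (cdf X r))%:E.
  by rewrite fineK// fin_num_abs gee0_abs// (le_lt_trans (cdf_le1 X r))// ltry.
have cdf1 r : fine (cdf X r) <= 1 by rewrite -lee_fin -cdf_fin cdf_le1.
move: ab_le_c; rewrite (cdf_fin x^-1) (cdf_fin y^-1) (cdf_fin (x + y)^-1).
rewrite -!EFinB -EFinM -EFinD !lee_fin.
exact: onem_subadditive.
Qed.
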